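(* Let $u\in X$ be a solution of the Dirichlet problem $(\mathcal P)$ with initial data $u_0$ and boundary data $\varphi$, and let $v\in X$ be a solution of $(\mathcal P)$ with initial data $v_0$ and boundary data $\psi$. If $u_0\le v_0$ in $\Omega$ and $\varphi\le\psi$ in $\partial^\mu\Omega\times[0,\infty)$, then $u\le v$ in all of $\bar\Omega\times[0,\infty)$.
   Context: $\Omega\subset\mathbb{R}^n$ is open, bounded, connected and regular (i.e. with smooth boundary). $\mu\in L^1(\mathbb{R}^n)$ is a nonnegative function with $\int_{\mathbb{R}^n}\mu(z)\,dz=1$; the symbol $\mu$ also denotes the measure $d\mu(z)=\mu(z)\,dz$. $C_b(Y)$ is the set of bounded continuous real-valued functions on $Y$, and $X=C_b(\bar\Omega\times[0,\infty))$. The domain of influence of $\Omega$ is $\bar\Omega^\mu=\overline{\bigcup_{x\in\Omega}(x+\mathrm{supp}\,\mu)}$, and the extended frontier is $\partial^\mu\Omega=\bar\Omega^\mu\setminus\Omega$. Initial data are functions in $C_b(\bar\Omega)$ and boundary data are functions in $C_b(\partial^\mu\Omega\times[0,\infty))$; the initial data $u_0$ and boundary data $\varphi$ of a problem satisfy $u_0=\varphi(\cdot,0)$ on $\partial\Omega\cap\partial^\mu\Omega$ (and likewise $v_0$ and $\psi$). Define the nonlocal operator $$K_\varphi(u)(x,t)=\int_{\{z:\,x+z\in\Omega\}}u(x+z,t)\,d\mu(z)+\int_{\{z:\,x+z\in\partial^\mu\Omega\}}\varphi(x+z,t)\,d\mu(z)-u(x,t).$$ A solution of the Dirichlet problem $(\mathcal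 P)$ with initial data $u_0$ and boundary data $\varphi$ is a function $u\in C(\Omega\times[0,\infty))$ such that $\partial_t u=K_\varphi(u)$ in $\Omega\times(0,\infty)$ in the sense of distributions and $u(\cdot,0)=u_0$ in $\Omega$. *)

(* Defs.v *)
From HB Require Import structures.
From mathcomp Require Import all_boot all_order all_algebra.
From mathcomp Require Import all_classical all_reals all_analysis.

Set Implicit Arguments.
Unset Strict Implicit.
Unset Printing Implicit Defensive.

Import Order.TTheory GRing.Theory Num.Theory.
Import numFieldNormedType.Exports.

Local Open Scope classical_set_scope.
Local Open Scope ring_scope.

Definition measure_rV_display : measure_display -> measure_display.
Proof. exact. Qed.

(* The product sigma-algebra on row vectors, as the library does for
   [n.-tuple T]. *)
Section measurable_rV.
Context {d} {T : sigmaRingType d} (n : nat).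

Let coors : 'I_n -> 'rV[T]_n -> T := fun i x => x ord0 i.

Let rV_set0 : g_sigma_preimage coors set0.
Proof. exact: sigma_algebra0. Qed.

Let rV_setC A : g_sigma_preimage coors A -> g_sigma_preimage coors (~` A).
Proof. exact: sigma_algebraC. Qed.

Let rV_bigcup (F : _^nat) : (forall i, g_sigma_preimage coors (F i)) ->
  g_sigma_preimage coors (\bigcup_i (F i)).
Proof. exact: sigma_algebra_bigcup. Qed.

HB.instance Definition _ := @isMeasurable.Build (measure_rV_display d)
  'rV[T]_n (g_sigma_preimage coors) rV_set0 rV_setC rV_bigcup.

End measurable_rV.

Section measurable_fun_rV.
Context d1 d2 (T1 : measurableType d1) (T2 : measurableType d2).

Lemma measurable_coor n (i : 'I_n) :
  measurable_fun [set: 'rV[T2]_n] (fun x : 'rV[T2]_n => x ord0 i).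
Proof.
move=> _ Y mY; rewrite setTI; apply: sub_sigma_algebra => /=.
rewrite -bigcup_seq/=; exists i => /=; first by rewrite mem_index_enum.
by exists Y => //; rewrite setTI.
Qed.

Lemma measurable_fun_rVP n (f : T1 -> 'rV[T2]_n) :
  measurable_fun [set: T1] f <->
  forall i, measurable_fun [set: T1] (fun x => f x ord0 i).
Proof.
split=> [mf i|mf].
  by apply: (@measurableT_comp _ _ _ _ _ _ (fun x : 'rV[T2]_n => x ord0 i));
    [exact: measurable_coor|].
move=> _ A mA; rewrite setTI.
pose F := [set B : set 'rV[T2]_n | measurable (f @^-1` B)].
suff : measurable `<=` F by apply.
apply: smallest_sub.
  split=> [|B mB|G mG] /=.
  - by rewrite /F/= preimage_set0.
  - by rewrite /F/= setTD preimage_setC; exact: measurableC.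
  - by rewrite /F/= preimage_bigcup; exact: bigcupT_measurable.
rewrite -bigcup_seq; apply: bigcup_sub => i _ B [C mC <-]; rewrite /F/=.
by rewrite setTI -comp_preimage -[X in measurable X]setTI; exact: mf.
Qed.

End measurable_fun_rV.

Section lebesgue_rV.
Context {R : realType}.

(* R^n x R -> R^(n+1), appending the last coordinate *)
Definition rV_rcons n (p : 'rV[R]_n * R) : 'rV[R]_n.+1 :=
  \row_i oapp (fun j => p.1 ord0 j) p.2 (unlift ord_max i).

Lemma measurable_rV_rcons n :
  measurable_fun [set: 'rV[R]_n * measurableTypeR R] (@rV_rcons n).
Proof.
apply/measurable_fun_rVP => i; rewrite /rV_rcons.
under eq_fun do rewrite mxE.
case: (unlift ord_max i) => [j|] /=; last exact: measurable_snd.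
by apply: (@measurableT_comp _ _ _ _ _ _ (fun x : 'rV[R]_n => x ord0 j));
  [exact: measurable_coor|exact: measurable_fst].
Qed.

(* The n-fold product of [lebesgue_measure]; see [lebesgue_rV_box]. *)
Fixpoint lebesgue_rV n : set 'rV[R]_n -> \bar R :=
  match n with
  | 0%N => \d_(0 : 'rV[R]_0)
  | n'.+1 =>
      pushforward (@lebesgue_rV n' \x @lebesgue_measure R)%E (@rV_rcons n')
  end.

Let lebesgue_rV_measure n :
  {m : {measure set 'rV[R]_n -> \bar R} | m = @lebesgue_rV n :> (set _ -> \bar R)}.
Proof.
elim: n => [|n [m mE]]; first by exists (\d_(0 : 'rV[R]_0)).
pose k : {measure set _ -> \bar R} := (m \x @lebesgue_measure R)%E.
exists (measure_function_pushforward__canonical__measure_function_Measure k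
  (@measurable_rV_rcons n)).
by rewrite /= /k/= mE.
Qed.

Let lebesgue_rV0 n : @lebesgue_rV n set0 = 0%E.
Proof. by have [m <-] := lebesgue_rV_measure n; exact: measure0. Qed.

Let lebesgue_rV_ge0 n A : (0 <= @lebesgue_rV n A)%E.
Proof. by have [m <-] := lebesgue_rV_measure n; exact: measure_ge0. Qed.

Let lebesgue_rV_semi_sigma_additive n : semi_sigma_additive (@lebesgue_rV n).
Proof.
by have [m <-] := lebesgue_rV_measure n; exact: measure_semi_sigma_additive.
Qed.

HB.instance Definition _ n := isMeasure.Build _ _ _ (@lebesgue_rV n)
  (@lebesgue_rV0 n) (@lebesgue_rV_ge0 n) (@lebesgue_rV_semi_sigma_additive n).

Lemma lebesgue_rV_box n (A : 'I_n -> set (measurableTypeR R)) :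
  (forall i, measurable (A i)) ->
  lebesgue_rV [set x : 'rV[R]_n | forall i, A i (x ord0 i)] =
  (\prod_(i < n) lebesgue_measure (A i))%E.
Proof.
elim: n => [|n IH] in A *.
  by move=> _; rewrite big_ord0 /= diracE mem_set// => -[].
move=> mA; rewrite big_ord_recr/= -IH; last by move=> i; exact: mA.
rewrite -product_measure1E//; last first.
  rewrite [X in measurable X](_ : _ = \bigcap_(i in [set: 'I_n])
      ((fun x : 'rV[R]_n => x ord0 i) @^-1` A (widen_ord (leqnSn n) i))).
    apply: fin_bigcap_measurable => [|i _]; first exact: finite_finset.
    rewrite -[X in measurable X]setTI.
    exact: (@measurable_coor _ _ _ i _ _ (mA _)).
  by apply/seteqP; split=> x /= H i; [move=> _; exact: H|exact: (H i I)].
rewrite /pushforward; congr (_ _); apply/seteqP; split=> -[x t] /=.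
  move=> H; split.
    move=> i; have := H (widen_ord (leqnSn n) i); rewrite mxE.
    have -> : widen_ord (leqnSn n) i = lift ord_max i.
      by apply/val_inj; rewrite /= /bump leqNgt ltn_ord.
    by rewrite liftK.
  by have := H ord_max; rewrite mxE unlift_none.
move=> [H Ht] i; rewrite mxE; case: unliftP => [j ->|->] //=.
have -> : lift ord_max j = widen_ord (leqnSn n) j.
  by apply/val_inj; rewrite /= /bump leqNgt ltn_ord.
exact: H.
Qed.

End lebesgue_rV.

Section smoothness.
Context {R : realType} {V : normedModType R}.
Implicit Types (U : set V) (f : V -> R).

(* [U] is meant to be open, so that ['D_v f] at points of [U] depends only on
   the values of [f] in [U]. *)
Fixpoint Ck_on U (k : nat) f : Prop :=
  (forall x, U x -> {for x, continuous f}) /\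
  match k with
  | 0%N => True
  | k'.+1 => forall v, (forall x, U x -> derivable f x v) /\
                       Ck_on U k' ('D_v f)
  end.

Definition smooth_on U f : Prop := forall k, Ck_on U k f.

Definition boundary U : set V := closure U `\` interior U.

(* Near each boundary point, [U] is one side of the zero set of a smooth
   function with nonvanishing differential. *)
Definition smooth_boundary U : Prop :=
  forall x0, boundary U x0 ->
    exists W f, [/\ open W, W x0, smooth_on W f, (exists v, 'D_v f x0 != 0) &
      forall x, W x -> (U x <-> f x < 0)].

Definition test_function U f : Prop :=
  smooth_on setT f /\
  exists K, [/\ compact K, K `<=` U & forall x, ~ K x -> f x = 0].

(* Only the restriction of [f] to [U] matters. *)
Definition Cb U f : Prop :=
  {within U, continuous f} /\ [bounded f x | x in U].

End smoothness.

Section nonlocal_dirichlet.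
Context {R : realType} (n : nat).
Implicit Types (Omega : set 'rV[R]_n) (mu : 'rV[R]_n -> R).
Implicit Types (u phi : 'rV[R]_n * R -> R).

Notation leb := (@lebesgue_rV R n).

Definition probability_density mu : Prop :=
  [/\ leb.-integrable setT (EFin \o mu), (forall z, 0 <= mu z) &
      (\int[leb]_z (mu z)%:E = 1)%E].

(* The support of the measure mu(z)dz. *)
Definition supp mu : set 'rV[R]_n :=
  [set z | forall U, open U -> U z -> (0 < \int[leb]_(y in U) (mu y)%:E)%E].

Definition influence Omega mu : set 'rV[R]_n :=
  closure (\bigcup_(x in Omega) [set x + z | z in supp mu]).

Definition ext_frontier Omega mu : set 'rV[R]_n :=
  influence Omega mu `\` Omega.

Definition nonlocal_op Omega mu phi u : 'rV[R]_n * R -> R := fun p =>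
  \int[leb]_(z in [set z | Omega (p.1 + z)]) (u (p.1 + z, p.2) * mu z) +
  \int[leb]_(z in [set z | ext_frontier Omega mu (p.1 + z)])
     (phi (p.1 + z, p.2) * mu z) - u p.

Definition nneg_times : set R := [set t | 0 <= t].
Definition pos_times : set R := [set t | 0 < t].

(* du/dt = g in the sense of distributions in the open set U *)
Definition distr_dt_eq (U : set ('rV[R]_n * R)) (u g : 'rV[R]_n * R -> R) :=
  forall eta, test_function U eta ->
    \int[(leb \x @lebesgue_measure R)%E]_(p in U)
       (u p * 'D_((0 : 'rV[R]_n), (1 : R)) eta p) =
    - \int[(leb \x @lebesgue_measure R)%E]_(p in U) (g p * eta p).

Definition admissible_data Omega mu (u0 : 'rV[R]_n -> R) phi : Prop :=
  [/\ Cb (closure Omega) u0, Cb (ext_frontier Omega mu `*` nneg_times) phi &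
      forall x, (boundary Omega `&` ext_frontier Omega mu) x ->
        u0 x = phi (x, 0)].

Definition dirichlet_solution Omega mu (u0 : 'rV[R]_n -> R) phi u : Prop :=
  [/\ {within Omega `*` nneg_times, continuous u},
      distr_dt_eq (Omega `*` pos_times) u (nonlocal_op Omega mu phi u) &
      forall x, Omega x -> u (x, 0) = u0 x].

End nonlocal_dirichlet.

(* Main.v *)
From HB Require Import structures.
Require Import Defs.
From mathcomp Require Import all_boot all_order all_algebra.
From mathcomp Require Import all_classical all_reals all_analysis.
From mathcomp Require Import measurable_realfun ring lra.
Import Order.TTheory GRing.Theory Num.Theory.
Import numFieldNormedType.Exports.
Local Open Scope classical_set_scope.
Local Open Scope ring_scope.

(** Write w = u - v, fix T > 0 and let M >= 0 bound w on Omega x [0, T).  Where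
    x + z lies in the extended frontier the data are ordered, and where x + z
    lies in Omega one has w <= M; as mu has mass one, the integral term of the
    operator for u exceeds that for v by at most M on Omega x [0, T).  Hence,
    in the sense of distributions,

      dw/dt <= M - w,   that is   d/dt (e^t (w - M)) <= 0.

    So e^t (w - M) is nonincreasing in time, and w <= 0 at time 0 gives
    w <= M (1 - e^-t) <= M (1 - e^-T): every bound M improves by the fixed
    factor 1 - e^-T < 1.  Taking for M the supremum of the positive part of w
    yields M = 0.  The case of the closure follows by continuity.  A single
    comparison with the constant M over the whole slab replaces both a
    maximum principle and any regularity of the nonlocal term.

    Passing from the distributional inequality to pointwise monotonicity needs
    genuine smooth test functions.  They are a(x) e^t b(t), where a is a bump
    around a point of Omega and b is a smooth plateau between two times s < t:
    b' is then a positive bump around s minus its translate around t, so that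
    testing compares the values of e^t (w - M) near (x, s) and near (x, t)
    ([weak_nonincreasing]).  The factor e^t in the test function absorbs the
    zeroth order term - w of the equation.  The bumps and
    plateaus are built from the flat function exp(-1/t), whose smoothness reduces to
    the fact that the family P(1/t) exp(-1/t), P a polynomial, is stable under
    differentiation ([is_derive_flat], [Ck_comp_tower]).

    The integral manipulations take place on compact cylinders, where measurable
    bounded functions are integrable.  This requires that open sets of
    R^n x R are measurable for the product sigma-algebra ([measurable_open]),
    that the nonlocal term is a measurable function of (x, t)
    ([measurable_average], by Tonelli), and that a function a(x) B'(t) has
    integral zero when B vanishes at both end times
    ([integral_time_derivative], by Fubini and the fundamental theorem of
    calculus). *)

(** * Calculus of iterated directional derivatives *)

(** The successive derivatives are given explicitly, so that an induction on the
    order of differentiation can move along the sequence. *)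
Definition derivative_tower {R : realType} (H : nat -> R -> R) :=
  forall (k : nat) (t : R), is_derive t (1 : R) (H k) (H k.+1 t).

Section smooth_calculus.
Context {R : realType} {V : normedModType R}.
Local Set Implicit Arguments.
Local Unset Strict Implicit.
Implicit Types (f g : V -> R) (h : R -> R) (x v : V).

(** Both difference quotients are the same function of the increment, which
    brings directional derivatives back to functions of one real variable. *)
Lemma is_derive_line f x v df :
  is_derive x v f df <-> is_derive (0 : R) 1 (fun t => f (t *: v + x)) df.
Proof.
have E : (fun t : R => t^-1 *: ((f \o shift x) (t *: v) - f x)) =
  (fun t : R => t^-1 *: (((fun t => f (t *: v + x)) \o shift (0 : R)) (t *: 1)
                     - f (0 *: v + x))).
  by apply/funext => t /=; rewrite addr0 scale0r add0r [_%:A]mulr1.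
by split=> -[df1 df2]; constructor; move: df1 df2;
  rewrite /derivable /derive /= E.
Qed.

Lemma is_derive_comp_real h g x v a b :
  is_derive (g x) 1 h a -> is_derive x v g b ->
  is_derive x v (h \o g) (a * b).
Proof.
move=> dh /is_derive_line dg; apply/is_derive_line.
apply: (@is_derive1_comp _ h (fun t => g (t *: v + x))) => //.
by rewrite scale0r add0r.
Qed.

Lemma Ck_onS k U f : Ck_on U k.+1 f -> Ck_on U k f.
Proof.
elim: k f => [|k IH] f; first by case.
by case=> cf df; split=> // v; have [d Dk] := df v; split=> //; exact: IH.
Qed.

Lemma Ck_cst k (c : R) : Ck_on setT k (cst c : V -> R).
Proof.
elim: k c => [|k IH] c; split=> //; try by move=> x _; exact: cvg_cst.
move=> v; split=> [x _|]; first exact: derivable_cst.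
rewrite (_ : 'D_v (cst c) = cst 0 :> (V -> R)); first exact: IH.
by apply/funext => x; rewrite derive_cst.
Qed.

Lemma CkD k f g : Ck_on setT k f -> Ck_on setT k g -> Ck_on setT k (f + g).
Proof.
elim: k f g => [|k IH] f g [cf df] [cg dg]; split=> //;
  try by move=> x _; apply: cvgD; [exact: cf|exact: cg].
move=> v; have [df1 df2] := df v; have [dg1 dg2] := dg v.
split=> [x _|]; first by apply: derivableD; [exact: df1|exact: dg1].
rewrite (_ : 'D_v (f + g) = 'D_v f + 'D_v g); first exact: IH.
by apply/funext => x; rewrite deriveD//; [exact: df1|exact: dg1].
Qed.

Lemma CkM k f g : Ck_on setT k f -> Ck_on setT k g -> Ck_on setT k (f * g).
Proof.
elim: k f g => [|k IH] f g Cf Cg; have [cf df] := Cf; have [cg dg] := Cg;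
  split=> //; try by move=> x _; apply: cvgM; [exact: cf|exact: cg].
move=> v; have [df1 df2] := df v; have [dg1 dg2] := dg v.
split=> [x _|]; first by apply: derivableM; [exact: df1|exact: dg1].
rewrite (_ : 'D_v (f * g) = f * 'D_v g + g * 'D_v f); last first.
  by apply/funext => x; rewrite deriveM//; [exact: df1|exact: dg1].
by apply: CkD; apply: IH => //; exact: Ck_onS.
Qed.

Lemma CkN k f : Ck_on setT k f -> Ck_on setT k (- f).
Proof.
move=> Cf; rewrite (_ : - f = cst (-1) * f); last first.
  by apply/funext => x; rewrite !fctE mulN1r.
by apply: CkM => //; exact: Ck_cst.
Qed.

Lemma Ck_sum k m (F : 'I_m -> V -> R) : (forall i, Ck_on setT k (F i)) ->
  Ck_on setT k (\sum_(i < m) F i).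
Proof.
move=> CF; elim/big_ind : _ => //; [exact: Ck_cst|exact: CkD].
Qed.

Lemma Ck_linear k (l : V -> R) :
  (forall a x y, l (a *: x + y) = a * l x + l y) -> continuous l ->
  Ck_on setT k l.
Proof.
move=> linl cl.
case: k => [|k]; split=> //; try by move=> x _; exact: cl.
move=> v; have D x : is_derive x v l (l v).
  have L : (fun h : R => h^-1 *: ((l \o shift x) (h *: v) - l x)) @ 0^' --> l v.
    apply: cvg_near_cst; near=> h.
    rewrite /= linl addrK scalerA mulVf ?scale1r//.
    near: h; exact: nbhs_dnbhs_neq.
  by split; [apply/cvg_ex; exists (l v)|exact: cvg_lim L].
split=> [x _|]; first by have [] := D x.
rewrite (_ : 'D_v l = cst (l v)); first exact: Ck_cst.
by apply/funext => x; have [] := D x.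
Unshelve. all: by end_near. Qed.

(** By the chain rule the derivative of [H j \o g] along [v] is
    [(H j.+1 \o g) * 'D_v g], again a product of a composition with a member of
    the tower and of a function that is smooth to one order less. *)
Lemma Ck_comp_tower (H : nat -> R -> R) j k g :
  derivative_tower H -> Ck_on setT k g -> Ck_on setT k (H j \o g).
Proof.
move=> tH; have cH i t : {for t, continuous (H i)}.
  by apply/differentiable_continuous/derivable1_diffP; have [] := tH i t.
elim: k j g => [|k IH] j g Cg; have [cg dg] := Cg; split=> //;
  try by move=> x _; apply: continuous_comp; [exact: cg|exact: cH].
move=> v; have [dg1 dg2] := dg v.
have D x : is_derive x v (H j \o g) (H j.+1 (g x) * 'D_v g x).
  by apply: is_derive_comp_real; [exact: tH|exact/derivableP/dg1].
split=> [x _|]; first by have [] := D x.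
rewrite (_ : 'D_v _ = (H j.+1 \o g) * 'D_v g).
  by apply: CkM => //; apply: IH => //; exact: Ck_onS.
by apply/funext => x; have [] := D x.
Qed.

End smooth_calculus.

(** * The flat function and smooth steps *)

Section flat_function.
Local Set Implicit Arguments.
Local Unset Strict Implicit.
Context {R : realType}.
Implicit Types (P : {poly R}) (t : R).

(** The extra power [s ^+ k] is carried along so that the induction on [P], which
    multiplies by the indeterminate, goes through. *)
Lemma poly_le_expR P k : exists2 C, 0 <= C &
  forall s, 0 <= s -> `|P.[s]| * s ^+ k <= C * expR s.
Proof.
have X m s : 0 <= s -> s ^+ m <= m`!%:R * expR s :> R.
  case: m => [|m] s0; first by rewrite expr0 mul1r -expR0 ler_expR.
  rewrite mulrC -ler_pdivrMr ?ltr0n ?fact_gt0//.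
  by apply: le_trans (expR_ge1Dxn m s0); rewrite lerDr.
elim/poly_ind: P k => [|P c IH] k.
  by exists 0 => // s s0; rewrite horner0 normr0 !mul0r.
have [C C0 HC] := IH k.+1.
exists (C + `|c| * k`!%:R); first by rewrite addr_ge0// mulr_ge0.
move=> s s0; rewrite hornerD hornerMX hornerC.
apply: (@le_trans _ _ (`|P.[s]| * s ^+ k.+1 + `|c| * s ^+ k)).
  rewrite exprS mulrA -mulrDl ler_wpM2r ?exprn_ge0//.
  by rewrite (le_trans (ler_normD _ _))// normrM (ger0_norm s0).
by rewrite mulrDl lerD ?HC// -mulrA ler_wpM2l// X.
Qed.

(** The polynomial parameter closes the family under differentiation; the usual
    flat function is [flat 1]. *)
Definition flat P t : R := if 0 < t then P.[t^-1] * expR (- t^-1) else 0.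

(** A quadratic bound at the origin is what differentiability there with
    derivative zero requires. *)
Lemma flat_bound P : exists C, forall t, `|flat P t| <= C * t ^+ 2.
Proof.
have [C C0 HC] := poly_le_expR P 2; exists C => t; rewrite /flat.
case: ifPn => t0; last by rewrite normr0 mulr_ge0// sqr_ge0.
have s0 : 0 < t^-1 by rewrite invr_gt0.
have := HC _ (ltW s0); rewrite normrM (ger0_norm (expR_ge0 _)) expRN.
rewrite -[_ / expR _]mulrC ler_pdivrMl ?expR_gt0// exprVn.
by rewrite ler_pdivrMr ?exprn_gt0// (mulrC (expR _)) mulrAC.
Qed.

Definition flat_step P := (P - P^`()) * 'X^2.

(** For [t > 0] this is the chain rule, [1/t] having derivative [- 1/t^2].  At the
    origin the difference quotient is bounded by a multiple of [t], thanks to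
    [flat_bound]. *)
Lemma is_derive_flat P t : is_derive t 1 (flat P) (flat (flat_step P) t).
Proof.
have [t0|t0|->] := ltgtP t 0.
- apply: (@near_eq_is_derive _ _ _ (cst 0)); last first.
    by rewrite /flat ltNge (ltW t0)/=; exact: is_derive_cst.
  by near=> s; rewrite /flat ltNge ifN// negbK; apply: ltW; near: s; exact: lt_nbhsl.
- pose F s := P.[s^-1] * expR (- s^-1).
  apply: (@near_eq_is_derive _ _ _ F).
    by near=> s; rewrite /flat ifT//; near: s; exact: lt_nbhsr.
  have dV : is_derive t 1 (fun s : R => s^-1) (- t ^- 2).
    have := @is_deriveV R id t 1 1 _ _; rewrite /= => H.
    by rewrite -[- _]mulr1; apply: H; rewrite gt_eqF.
  have dP := is_derive1_comp (is_derive_poly P t^-1) dV.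
  have dN : is_derive t 1 (fun s : R => - s^-1) (t ^- 2).
    by rewrite -[X in is_derive _ _ _ X]opprK; exact: is_deriveN.
  have dE := @is_derive1_comp R expR (fun s => - s^-1) t _ _
    (is_derive_expR (- t^-1)) dN.
  have dM : is_derive t 1 F _ := is_deriveM dP dE.
  apply: (is_derive_eq dM).
  rewrite /flat t0 /flat_step hornerM hornerD hornerN hornerXn /=.
  rewrite /GRing.scale/= exprVn; ring.
- rewrite {2}/flat ltxx; have [C HC] := flat_bound P.
  have f0 : flat P 0 = 0 by rewrite /flat ltxx.
  have L : (fun h : R => h^-1 *: ((flat P \o shift 0) (h *: 1) - flat P 0))
       @ 0^' --> (0 : R).
    apply/cvgr0Pnorm_le => e e0; near=> h.
    rewrite /= addr0 f0 subr0 [_%:A]mulr1 normrZ normfV.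
    rewrite ler_pdivrMl ?normr_gt0//; last by near: h; exact: nbhs_dnbhs_neq.
    apply: le_trans (HC _) _; rewrite -real_normK ?num_real// expr2 mulrA.
    rewrite mulrC ler_wpM2l//.
    apply: (@le_trans _ _ ((`|C| + 1) * `|h|)).
      by rewrite ler_wpM2r// (le_trans (ler_norm _))// lerDl.
    rewrite -ler_pdivlMl ?ltr_wpDl//.
    near: h; apply: dnbhs0_le; first by rewrite mulr_gt0// invr_gt0 ltr_wpDl.
  by split; [apply/cvg_ex; exists 0|exact: cvg_lim L].
Unshelve. all: by end_near. Qed.

Lemma flat_tower P : derivative_tower (fun k => flat (iter k flat_step P)).
Proof. by move=> k t; rewrite iterS; exact: is_derive_flat. Qed.


Lemma flat_le0 P t : t <= 0 -> flat P t = 0.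
Proof. by move=> t0; rewrite /flat ltNge t0. Qed.

Lemma flat1_ge0 t : 0 <= flat 1 t.
Proof.
by rewrite /flat; case: ifP => // _; rewrite hornerC mul1r expR_ge0.
Qed.

Lemma flat1_gt0 t : 0 < t -> 0 < flat 1 t.
Proof. by move=> t0; rewrite /flat t0 hornerC mul1r expR_gt0. Qed.

Lemma flat1_lt s t : 0 < s -> s < t -> flat 1 s < flat 1 t.
Proof.
move=> s0 st; have t0 := lt_trans s0 st.
by rewrite /flat s0 t0 !hornerC !mul1r ltr_expR ltrN2 ltf_pV2.
Qed.

Lemma flat1_le s t : s <= t -> flat 1 s <= flat 1 t.
Proof.
rewrite le_eqVlt => /predU1P[->//|st].
have [s0|s0] := ltP 0 s; first exact/ltW/flat1_lt.
by rewrite flat_le0// flat1_ge0.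
Qed.

Definition dflat1 := flat (flat_step 1).

Lemma dflat1E t : 0 < t -> dflat1 t = t^-1 ^+ 2 * expR (- t^-1).
Proof.
move=> t0; rewrite /dflat1 /flat t0 /flat_step.
by rewrite -[1]/(1%:P) derivC subr0 mul1r hornerXn.
Qed.

Lemma dflat1_gt0 t : 0 < t -> 0 < dflat1 t.
Proof.
by move=> t0; rewrite dflat1E// mulr_gt0 ?expR_gt0// exprn_gt0// invr_gt0.
Qed.

Lemma dflat1_ge0 t : 0 <= dflat1 t.
Proof.
have [/dflat1_gt0/ltW//|t0] := ltP 0 t.
by rewrite /dflat1 flat_le0.
Qed.

(** A smooth nondecreasing step, constant outside [[- d, d]].  Composing the flat
    function with itself produces both plateaus without a quotient or a
    primitive: for [t <= - d] the inner value is [0], and for [d <= t] the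
    argument of the outer one is nonpositive. *)
Definition ramp (d t : R) := - flat 1 (flat 1 (d + d) - flat 1 (t + d)).

Definition dramp (d t : R) :=
  dflat1 (flat 1 (d + d) - flat 1 (t + d)) * dflat1 (t + d).

Lemma ramp_le d s t : s <= t -> ramp d s <= ramp d t.
Proof.
by move=> st; rewrite /ramp lerN2 flat1_le// lerD2l lerN2 flat1_le// lerD2r.
Qed.

Lemma ramp_left d t : t <= - d -> ramp d t = - flat 1 (flat 1 (d + d)).
Proof.
by move=> td; rewrite /ramp [flat _ (t + d)]flat_le0 ?subr0//; lra.
Qed.

Lemma ramp_right d t : d <= t -> ramp d t = 0.
Proof.
move=> dt; rewrite /ramp flat_le0 ?oppr0// subr_le0 flat1_le//; lra.
Qed.

Lemma dramp_ge0 d t : 0 <= dramp d t.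
Proof. by rewrite mulr_ge0 ?dflat1_ge0. Qed.

Lemma dramp_out (d : R) t : d <= `|t| -> dramp d t = 0.
Proof.
move=> dt; rewrite /dramp /dflat1.
have [t0|t0] := leP 0 t.
  rewrite [flat _ (_ - _)]flat_le0 ?mul0r// subr_le0 flat1_le//.
  by rewrite lerD2r -(ger0_norm t0).
rewrite [flat (flat_step _) (t + d)]flat_le0 ?mulr0//.
by move: dt; rewrite ltr0_norm// => dt; lra.
Qed.

Lemma dramp_gt0 d : 0 < d -> 0 < dramp d 0.
Proof.
move=> d0; rewrite mulr_gt0 ?dflat1_gt0 ?add0r// subr_gt0 flat1_lt//; lra.
Qed.

Lemma is_derive_ramp d t : is_derive t 1 (ramp d) (dramp d t).
Proof.
have d1 : is_derive t 1 (fun t : R => flat 1 (t + d)) (dflat1 (t + d) * 1).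
  apply: (@is_derive1_comp R (flat 1) (fun t => t + d)).
    exact: is_derive_flat.
  exact: is_derive_shift.
have d2 : is_derive t 1 (fun t => flat 1 (d + d) - flat 1 (t + d))
    (0 - dflat1 (t + d) * 1).
  by apply: (@is_deriveB _ _ _ (cst _)); exact: is_derive_cst.
have d3 := @is_derive1_comp R (flat 1) _ t _ _ (is_derive_flat 1 _) d2.
apply: (is_derive_eq (is_deriveN d3)).
by rewrite /dramp /dflat1 /=; ring.
Qed.

(** A plateau between the times [s] and [t]; its derivative is a bump at [s] minus
    the same bump at [t]. *)
Definition window (d s t x : R) := ramp d (x - s) - ramp d (x - t).

Definition dwindow (d s t x : R) := dramp d (x - s) - dramp d (x - t).

Lemma window_ge0 d s t x : s <= t -> 0 <= window d s t x.
Proof. by move=> st; rewrite subr_ge0 ramp_le// lerD2l lerN2. Qed.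

Lemma window_out d s t x : s <= t -> x <= s - d \/ t + d <= x ->
  window d s t x = 0.
Proof.
by move=> st [xs|tx]; rewrite /window;
  [rewrite !ramp_left ?subrr//; lra|rewrite !ramp_right ?subrr//; lra].
Qed.

Lemma is_derive_window (d s t x : R) :
  is_derive x 1 (window d s t) (dwindow d s t x).
Proof.
have D (c : R) : is_derive x 1 (fun x : R => ramp d (x - c)) (dramp d (x - c)).
  rewrite -[dramp _ _]mulr1.
  apply: (@is_derive1_comp R (ramp d) (fun x => x - c)).
    exact: is_derive_ramp.
  exact: is_derive_shift.
exact: is_deriveB (D s) (D t).
Qed.

End flat_function.

(** * Test functions supported in space-time cylinders *)

Section test_functions.
Context {R : realType} {n : nat}.
Local Set Implicit Arguments.
Local Unset Strict Implicit.
Local Notation V := ('rV[R]_n * R)%type.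
Implicit Types (c x : 'rV[R]_n) (p : V) (r d s t : R).

Definition cube r c : set 'rV[R]_n :=
  [set x | forall i, `|x ord0 i - c ord0 i| <= r].

Definition space_bump r c x : R :=
  flat 1 (r ^+ 2 - \sum_i (x ord0 i - c ord0 i) ^+ 2).

Lemma space_bump_ge0 r c x : 0 <= space_bump r c x.
Proof. exact: flat1_ge0. Qed.

Lemma space_bump_center r c : 0 < r -> 0 < space_bump r c c.
Proof.
move=> r0; apply: flat1_gt0; rewrite big1 ?subr0 ?exprn_gt0//.
by move=> i _; rewrite subrr expr0n.
Qed.

(** The support is in fact the Euclidean ball of radius [r], which lies in the
    cube. *)
Lemma space_bump_out r c x : 0 <= r -> ~ cube r c x -> space_bump r c x = 0.
Proof.
move=> r0 /existsNP[i /negP]; rewrite -ltNge => rx; apply: flat_le0.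
rewrite subr_le0 (bigD1 i)//= -[leLHS]addr0 lerD ?sumr_ge0//.
  by rewrite -(@real_normK _ (_ - _)) ?num_real// lerXn2r ?nnegrE// ltW.
by move=> j _; exact: sqr_ge0.
Qed.

Lemma Ck_snd k : Ck_on setT k (fun p => p.2).
Proof. by apply: Ck_linear => // p; exact: cvg_snd. Qed.

Lemma Ck_coord k i : Ck_on setT k (fun p => p.1 ord0 i).
Proof.
apply: Ck_linear => [a p q|p]; first by rewrite !mxE.
apply: (@continuous_comp _ _ _ fst (fun x : 'rV[R]_n => x ord0 i)).
  exact: cvg_fst.
exact: coord_continuous.
Qed.

Lemma Ck_flat P k (g : V -> R) :
  Ck_on setT k g -> Ck_on setT k (flat P \o g).
Proof. exact: (@Ck_comp_tower _ _ _ 0 k g (flat_tower P)). Qed.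

Lemma Ck_space_bump k r c : Ck_on setT k (fun p => space_bump r c p.1).
Proof.
pose F i : V -> R := (fun p => p.1 ord0 i) - cst (c ord0 i).
have CF i : Ck_on setT k (F i).
  by apply: CkD; [exact: Ck_coord|apply: CkN; exact: Ck_cst].
have := Ck_flat 1 (CkD (Ck_cst k (r ^+ 2)) (CkN (Ck_sum
  (fun i => CkM (CF i) (CF i))))).
congr (Ck_on _ _ _); apply/funext => p.
rewrite /comp /space_bump; congr (flat _ _); rewrite !fctE fct_sumE.
by congr (_ - _); apply: eq_bigr => i _; rewrite expr2.
Qed.

Lemma Ck_ramp k d (g : V -> R) :
  Ck_on setT k g -> Ck_on setT k (ramp d \o g).
Proof.
move=> Cg; have := CkN (Ck_flat 1 (CkD (Ck_cst k (flat 1 (d + d)))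
  (CkN (Ck_flat 1 (CkD Cg (Ck_cst k d)))))).
by congr (Ck_on _ _ _); apply/funext.
Qed.

Lemma Ck_window k d s t : Ck_on setT k (fun p => window d s t p.2).
Proof.
have C a : Ck_on setT k (fun p => ramp d (p.2 - a)).
  have := Ck_ramp d (CkD (Ck_snd k) (CkN (Ck_cst k a))).
  by congr (Ck_on _ _ _); apply/funext.
by have := CkD (C s) (CkN (C t)); congr (Ck_on _ _ _); apply/funext.
Qed.

Lemma Ck_expR k : Ck_on setT k (fun p => expR p.2).
Proof.
have T : derivative_tower (fun=> @expR R) by move=> j t; exact: is_derive_expR.
by have := Ck_comp_tower 0 T (Ck_snd k).
Qed.

(** The exponential factor is the integrating factor of [dw/dt = - w]. *)
Definition cylinder_bump r c d s t p : R :=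
  space_bump r c p.1 * (expR p.2 * window d s t p.2).

Lemma smooth_cylinder_bump r c d s t : smooth_on setT (cylinder_bump r c d s t).
Proof.
move=> k.
have := CkM (Ck_space_bump k r c) (CkM (Ck_expR k) (Ck_window k d s t)).
by congr (Ck_on _ _ _); apply/funext.
Qed.

Lemma is_derive_time_prod (a : 'rV[R]_n -> R) (b : R -> R) (db : R) p :
  is_derive p.2 1 b db ->
  is_derive p ((0 : 'rV[R]_n), (1 : R)) (fun p => a p.1 * b p.2) (a p.1 * db).
Proof.
move=> /is_derive_line db1; apply/is_derive_line.
have := is_deriveZ (a p.1) db1; congr (is_derive _ _ _ _).
by apply/funext => t /=; rewrite scaler0 add0r.
Qed.

(** The term with [window] is the test function itself; it will cancel the term
    [- u] of the nonlocal operator. *)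
Lemma derive_cylinder_bump r c d s t p :
  'D_((0 : 'rV[R]_n), (1 : R)) (cylinder_bump r c d s t) p =
  space_bump r c p.1 * (expR p.2 * (window d s t p.2 + dwindow d s t p.2)).
Proof.
have dM := is_deriveM (is_derive_expR p.2) (is_derive_window d s t p.2).
have [_ ->] := is_derive_time_prod (p := p) (space_bump r c) dM.
by rewrite /GRing.scale/=; ring.
Qed.

Lemma compact_cube r c : compact (cube r c).
Proof.
have := @rV_compact R n (fun i => `[c ord0 i - r, c ord0 i + r]%classic)
  (fun i => @segment_compact _ _ _).
congr compact; apply/seteqP; split=> x /= H i; have := H i;
  by rewrite in_itv/= ler_distl.
Qed.

Lemma compact_cylinder r c s t : compact (cube r c `*` `[s, t]).
Proof. apply: compact_setX; [exact: compact_cube|exact: segment_compact]. Qed.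

Lemma cylinder_bump_out r c d s t p : 0 <= r -> s <= t ->
  ~ (cube r c `*` `[s - d, t + d]) p -> cylinder_bump r c d s t p = 0.
Proof.
move=> r0 st /not_andP[px|pt].
  by rewrite /cylinder_bump space_bump_out ?mul0r.
rewrite /cylinder_bump window_out ?mulr0//.
move/negP: pt; rewrite in_itv/= negb_and -!ltNge => /orP[] /ltW; tauto.
Qed.

Lemma test_function_cylinder_bump (U : set V) r c d s t : 0 <= r -> s <= t ->
  cube r c `*` `[s - d, t + d] `<=` U -> test_function U (cylinder_bump r c d s t).
Proof.
move=> r0 st KU; split; first exact: smooth_cylinder_bump.
exists (cube r c `*` `[s - d, t + d]); split=> //.
  exact: compact_cylinder.
by move=> p; exact: cylinder_bump_out.
Qed.

End test_functions.

(** * Borel sets and continuous functions on space-time *)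

Section borel_sets.
Context {R : realType} {n : nat}.
Local Set Implicit Arguments.
Local Unset Strict Implicit.
Local Notation V := ('rV[R]_n * R)%type.
Implicit Types (c x : 'rV[R]_n) (p : V).

Lemma measurable_coords (A : 'I_n -> set R) : (forall i, measurable (A i)) ->
  measurable [set x : 'rV[R]_n | forall i, A i (x ord0 i)].
Proof.
move=> mA; rewrite (_ : mkset _ = \bigcap_(i in [set: 'I_n])
    ((fun x : 'rV[R]_n => x ord0 i) @^-1` (A i))).
  apply: fin_bigcap_measurable => [|i _]; first exact: finite_finset.
  by rewrite -[X in measurable X]setTI; exact: (@measurable_coor _ _ _ i _ _ (mA i)).
by apply/seteqP; split=> x /= H i; [move=> _; exact: H|exact: (H i I)].
Qed.

(** The product sigma-algebra contains the cubes with rational centre and radius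
    [1 / (m + 1)], and an open set is the countable union of those it
    contains. *)
Lemma measurable_open (A : set V) : open A -> measurable A.
Proof.
move=> oA.
pose box (k : 'rV[rat]_n * rat * nat) : set V :=
  [set x : 'rV[R]_n | forall i, ball (ratr (k.1.1 ord0 i) : R) k.2.+1%:R^-1 (x ord0 i)]
  `*` ball (ratr k.1.2 : R) k.2.+1%:R^-1.
have mbox k : measurable (box k).
  have mb (a e : R) : measurable (ball a e).
    by rewrite ball_itv; exact: measurable_itv.
  apply: measurableX; last exact: mb.
  exact: (@measurable_coords (fun i => ball _ _) (fun i => mb _ _)).
have -> : A = \bigcup_(k in [set k | box k `<=` A]) box k.
  apply/seteqP; split=> [p Ap|p [k kA /kA]//].
  have /nbhs_ballP[e /= e0 eA] : nbhs p A by exact: open_nbhs_nbhs.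
  (* Half of the radius: a cube centred at a rational point near p is covered by
     a ball around p of twice its radius. *)
  have [m me] := @ltr_add_invr R 0 (e / 2) (divr_gt0 e0 (ltr0Sn _ _)).
  rewrite add0r in me; have m0 : 0 < m.+1%:R^-1 :> R by rewrite invr_gt0.
  have Q (a : R) : exists q : rat, ball (ratr q : R) m.+1%:R^-1 a.
    have ba : ball a m.+1%:R^-1 a by exact: ballxx.
    have [y [/= xa [q _ qE]]] := @dense_rat R _
      (ex_intro _ a ba) (ball_open a m.+1%:R^-1).
    by exists q; rewrite qE; exact: ball_sym.
  have [q1 q1P] := choice (fun i => Q (p.1 ord0 i)); have [q2 q2P] := Q p.2.
  exists ((\row_i q1 i, q2), m) => /=; last first.
    by split => //= i; rewrite mxE.
  have E : m.+1%:R^-1 + m.+1%:R^-1 <= e by rewrite [leRHS]splitr lerD ?ltW.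
  move=> y [/= y1 y2]; apply: eA; split=> /=.
    split => // i j; rewrite ord1.
    apply: le_ball E _ _; apply: ball_triangle (ball_sym (q1P j)) _.
    by have := y1 j; rewrite mxE.
  exact: (le_ball E (ball_triangle (ball_sym q2P) y2)).
rewrite bigcup_mkcond; apply: countable_bigcupT_measurable => // k.
by case: ifP.
Qed.

(** An open set of space is a section of an open set of space-time. *)
Lemma measurable_open_rV (A : set 'rV[R]_n) : open A -> measurable A.
Proof.
move=> oA; have oAT : open ((fun p : V => p.1) @^-1` A).
  by apply: open_comp => // p _; exact: cvg_fst.
have := @pair2_measurable _ _ 'rV[R]_n R (0 : R) measurableT _
  (measurable_open oAT).
by rewrite setTI.
Qed.

Lemma measurable_closed_rV (A : set 'rV[R]_n) : closed A -> measurable A.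
Proof. by move/closed_openC/measurable_open_rV/measurableC; rewrite setCK. Qed.

Lemma within_continuous_measurable (D : set V) (f : V -> R) :
  measurable D -> {within D, continuous f} -> measurable_fun D f.
Proof.
move=> mD /continuousP cf; apply: (measurability _ (RGenOpens.measurableE R)).
move=> _ [_ [a [b ->] <-]].
have : open (f @^-1` `]a, b[%classic : set (subspace D)).
  by apply: cf; exact: interval_open.
move=> /open_subspaceP[W oW WD].
by rewrite setIC -WD; apply: measurableI => //; exact: measurable_open.
Qed.

End borel_sets.

(** * Averaging against the density *)

Section cube_measure.
Context {R : realType} {n : nat}.
Local Set Implicit Arguments.
Local Unset Strict Implicit.
Local Notation leb := (@lebesgue_rV R n).
Implicit Types (c x : 'rV[R]_n) (r : R).

Lemma cubeE r c :
  cube r c = [set x | forall i, `[c ord0 i - r, c ord0 i + r]%classic (x ord0 i)].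
Proof.
by apply/seteqP; split=> x /= H i; have := H i; rewrite in_itv/= ler_distl.
Qed.

Lemma lebesgue_cube r c : 0 <= r -> leb (cube r c) = ((r + r) ^+ n)%:E.
Proof.
move=> r0; rewrite cubeE (lebesgue_rV_box (fun i => measurable_itv _)).
rewrite (eq_bigr (fun=> (r + r)%:E)) => [|i _]; last first.
  rewrite lebesgue_measure_itv/= lte_fin.
  case: ltP => [_|]; first by rewrite -EFinB; congr (_%:E); ring.
  by move=> ?; congr EFin; lra.
by rewrite prodEFin prodr_const card_ord.
Qed.

Lemma measurable_cube r c : measurable (cube r c).
Proof. by rewrite cubeE; exact: (measurable_coords (fun i => measurable_itv _)). Qed.

(** Needed for the theorems of Tonelli and Fubini. *)
Lemma lebesgue_rV_sigma_finite : sigma_finite setT leb.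
Proof.
exists (fun k => cube k%:R 0) => [|k]; last first.
  by split; [exact: measurable_cube|rewrite lebesgue_cube ?ltry].
apply/esym/seteqP; split=> // x _.
pose s := \sum_i `|x ord0 i|.
have s0 : 0 <= s by exact: sumr_ge0.
exists (Num.bound s) => // i; rewrite mxE subr0.
apply: le_trans (ltW (archi_boundP s0)).
by rewrite /s (bigD1 i)//= lerDl sumr_ge0.
Qed.

End cube_measure.

HB.instance Definition _ (R : realType) (n : nat) :=
  Measure_isSigmaFinite.Build _ _ _ (@lebesgue_rV R n)
    (@lebesgue_rV_sigma_finite R n).

Section averaging.
Context {R : realType} {n : nat}.
Local Set Implicit Arguments.
Local Unset Strict Implicit.
Local Notation V := ('rV[R]_n * R)%type.
Local Notation leb := (@lebesgue_rV R n).
Implicit Types (W : V -> R) (p : V) (C : R).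
Variable mu : 'rV[R]_n -> R.
Hypothesis mu_density : probability_density mu.

(** The convolution of [W] with the reflected density, at fixed time. *)
Definition average (W : V -> R) (p : V) : R :=
  \int[leb]_z (W (p.1 + z, p.2) * mu z).

Let mmu : measurable_fun setT mu.
Proof.
by have [/integrableP[/measurable_EFinP]] := mu_density.
Qed.

Let mshift : measurable_fun [set: V * 'rV[R]_n]
  (fun q => (q.1.1 + q.2, q.1.2) : V).
Proof.
apply: measurable_fun_pair.
  apply/measurable_fun_rVP => i; under eq_fun do rewrite mxE.
  apply: measurable_funD.
    apply: (@measurableT_comp _ _ _ _ _ _ (fun x : 'rV[R]_n => x ord0 i)).
      exact: measurable_coor.
    by apply: measurableT_comp; exact: measurable_fst.
  apply: (@measurableT_comp _ _ _ _ _ _ (fun x : 'rV[R]_n => x ord0 i)).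
    exact: measurable_coor.
  exact: measurable_snd.
apply: (@measurableT_comp _ _ _ _ _ _ snd); first exact: measurable_snd.
exact: measurable_fst.
Qed.

Let mjoint (W : V -> R) : measurable_fun setT W -> measurable_fun [set: V * 'rV[R]_n]
  (fun q => W (q.1.1 + q.2, q.1.2) * mu q.2).
Proof.
move=> mW; apply: measurable_funM.
  by apply: (@measurableT_comp _ _ _ _ _ _ W) => //; exact: mshift.
by apply: (@measurableT_comp _ _ _ _ _ _ mu) => //; exact: measurable_snd.
Qed.

Lemma average_integrable (W : V -> R) (C : R) (p : V) : measurable_fun setT W ->
  (forall q, `|W q| <= C) ->
  leb.-integrable setT (EFin \o (fun z => W (p.1 + z, p.2) * mu z)).
Proof.
move=> mW WC; have [imu mu0 _] := mu_density.
have C0 : 0 <= C by apply: le_trans (WC p).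
apply: (@le_integrable _ _ _ leb setT measurableT _ (fun z => (C%:E * (EFin \o mu) z)%E)).
- apply/measurable_EFinP.
  exact: (@measurableT_comp _ _ _ _ _ _ _ _ (pair p) (mjoint mW)).
- move=> z _; rewrite /= lee_fin !normrM (ger0_norm (mu0 z)) (ger0_norm C0).
  by rewrite ler_wpM2r.
- exact: integrableZl.
Qed.

Lemma average_cst C p : average (cst C) p = C.
Proof.
have [imu mu0 mu1] := mu_density.
by rewrite /average /= RintegralZl// /Rintegral mu1 mulr1.
Qed.

Lemma averageD (W1 W2 : V -> R) (C1 C2 : R) (p : V) :
  measurable_fun setT W1 -> (forall q, `|W1 q| <= C1) ->
  measurable_fun setT W2 -> (forall q, `|W2 q| <= C2) ->
  average (W1 + W2) p = average W1 p + average W2 p.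
Proof.
move=> m1 b1 m2 b2; rewrite /average -RintegralD//.
- by apply: eq_Rintegral => z _; rewrite !fctE mulrDl.
- exact: average_integrable b1.
- exact: average_integrable b2.
Qed.

Lemma average_le (W1 W2 : V -> R) (C1 C2 : R) (p : V) :
  measurable_fun setT W1 -> (forall q, `|W1 q| <= C1) ->
  measurable_fun setT W2 -> (forall q, `|W2 q| <= C2) ->
  (forall x, W1 (x, p.2) <= W2 (x, p.2)) -> average W1 p <= average W2 p.
Proof.
move=> m1 b1 m2 b2 W12; have [_ mu0 _] := mu_density.
apply: le_Rintegral => //.
- exact: average_integrable b1.
- exact: average_integrable b2.
- by move=> z _; rewrite ler_wpM2r.
Qed.

Lemma average_bound (W : V -> R) (C : R) (p : V) : measurable_fun setT W ->
  (forall q, `|W q| <= C) -> `|average W p| <= C.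
Proof.
move=> mW WC.
have C0 : 0 <= C by apply: le_trans (WC p).
rewrite ler_norml; apply/andP; split.
  rewrite -[leLHS](@average_cst _ p).
  apply: (@average_le (cst (- C)) W C C p) => //.
    by move=> q; rewrite /= normrN ger0_norm.
  by move=> x /=; have := WC (x, p.2); rewrite ler_norml => /andP[].
rewrite -[leRHS](@average_cst _ p).
apply: (@average_le W (cst C) C C p) => //.
  by move=> q; rewrite /= ger0_norm.
by move=> x /=; have := WC (x, p.2); rewrite ler_norml => /andP[].
Qed.

(** Tonelli's theorem gives measurability of the integral of a nonnegative
    function of [((x, t), z)]; a bounded [W] is made nonnegative by adding a
    constant, which shifts the average by that constant as [mu] has mass one. *)
Lemma measurable_average (W : V -> R) (C : R) : measurable_fun setT W ->
  (forall q, `|W q| <= C) -> measurable_fun setT (average W).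
Proof.
move=> mW WC; have [_ mu0 _] := mu_density.
pose W' := W + cst C.
have mW' : measurable_fun setT W' by exact: measurable_funD.
have -> : average W = average W' - cst C.
  apply/funext => p; rewrite !fctE /W' (@averageD _ _ C `|C|)//.
  by rewrite average_cst addrK.
apply: measurable_funB => //.
have := @measurable_fun_fubini_tonelli_F _ _ V 'rV[R]_n R leb
  (fun q => (W' (q.1.1 + q.2, q.1.2) * mu q.2)%:E) _ _.
move=> mF; apply: (measurableT_comp (@fine_measurable R setT measurableT)).
apply: mF; first by apply/measurable_EFinP; exact: mjoint.
move=> q; rewrite lee_fin mulr_ge0// /W' !fctE.
by have := WC (q.1.1 + q.2, q.1.2); rewrite ler_norml => /andP[]; lra.
Qed.

End averaging.

(** * Integrals over space-time cylinders *)

Section continuity_dwindow.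
Context {R : realType}.
Local Set Implicit Arguments.
Local Unset Strict Implicit.

Lemma is_derive_continuous (f df : R -> R) :
  (forall t, is_derive t (1 : R) f (df t)) -> continuous f.
Proof.
by move=> H t; apply/differentiable_continuous/derivable1_diffP; have [] := H t.
Qed.

Lemma continuous_dramp (d : R) : continuous (dramp d).
Proof.
have cf P : continuous (@flat R P).
  exact: (is_derive_continuous (fun t => is_derive_flat P t)).
have cs : continuous (fun t : R => t + d).
  by move=> t; apply: cvgD; [exact: cvg_id|exact: cvg_cst].
move=> t; apply: cvgM.
  apply: (@continuous_comp _ _ _ (fun t => flat 1 (d + d) - flat 1 (t + d)));
    last exact: cf.
  apply: cvgB; first exact: cvg_cst.
  by apply: (@continuous_comp _ _ _ (fun t => t + d)); [exact: cs|exact: cf].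
by apply: (@continuous_comp _ _ _ (fun t => t + d)); [exact: cs|exact: cf].
Qed.

Lemma continuous_dwindow (d s t : R) : continuous (dwindow d s t).
Proof.
have C (c : R) : continuous (fun x => dramp d (x - c)).
  move=> x; apply: (@continuous_comp _ _ _ (fun x => x - c)).
    by apply: cvgB; [exact: cvg_id|exact: cvg_cst].
  exact: continuous_dramp.
by move=> x; apply: cvgB; exact: C.
Qed.

End continuity_dwindow.

Section cylinder_integrals.
Context {R : realType} {n : nat}.
Local Set Implicit Arguments.
Local Unset Strict Implicit.
Local Notation V := ('rV[R]_n * R)%type.
Local Notation vol := (@lebesgue_rV R n \x @lebesgue_measure R)%E.

(** Moves integrals over an open set, where integrability is not clear, to the
    compact support of the integrand. *)
Lemma Rintegral_support (U K : set V) (f : V -> R) : K `<=` U ->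
  (forall p, U p -> ~ K p -> f p = 0) ->
  \int[vol]_(p in U) f p = \int[vol]_(p in K) f p.
Proof.
move=> KU f0; rewrite Rintegral_mkcond [RHS]Rintegral_mkcond.
apply: eq_Rintegral => p _; rewrite !patchE.
have [pK|pK] := boolP (p \in K); first by rewrite mem_set//; exact/KU/set_mem.
have [pU|//] := boolP (p \in U).
by rewrite f0//; [exact: set_mem|move/mem_set; apply/negP].
Qed.

Variables (r : R) (c : 'rV[R]_n) (a b : R).
Let K : set V := cube r c `*` `[a, b].

(** Unlike integrability this is stable under products, and it implies
    integrability as the cylinder has finite volume. *)
Definition tame (f : V -> R) :=
  measurable_fun K f /\ exists C, forall p, K p -> `|f p| <= C.

Lemma measurable_cylinder : measurable K.
Proof. by apply: measurableX; [exact: measurable_cube|exact: measurable_itv]. Qed.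

Lemma volume_cylinder : 0 <= r -> a <= b ->
  vol K = ((r + r) ^+ n * (b - a))%:E.
Proof.
move=> r0 ab; rewrite product_measure1E//; last exact: measurable_cube.
rewrite /= lebesgue_cube// lebesgue_measure_itv/= lte_fin.
case: ltP => [_|ba]; first by rewrite -EFinB -EFinM.
by rewrite mule0 (le_anti (introT andP (conj ab ba))) subrr mulr0.
Qed.

Lemma tame_within_continuous f : {within K, continuous f} -> tame f.
Proof.
move=> cf; split.
  by apply: within_continuous_measurable => //; exact: measurable_cylinder.
have /compact_bounded[M [_ HM]] : compact (f @` K).
  by apply: continuous_compact => //; exact: compact_cylinder.
exists (`|M| + 1) => p Kp; apply: HM; last by exists p.
by rewrite (le_lt_trans (ler_norm _))// ltrDl.
Qed.

Lemma tame_continuous f : continuous f -> tame f.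
Proof.
by move=> cf; apply: tame_within_continuous; exact: continuous_subspaceT.
Qed.

Lemma tameD f g : tame f -> tame g -> tame (f + g).
Proof.
move=> [mf [C1 b1]] [mg [C2 b2]]; split; first exact: measurable_funD.
by exists (C1 + C2) => p Kp; rewrite (le_trans (ler_normD _ _))// lerD ?b1 ?b2.
Qed.

Lemma tameM f g : tame f -> tame g -> tame (f * g).
Proof.
move=> [mf [C1 b1]] [mg [C2 b2]]; split; first exact: measurable_funM.
by exists (C1 * C2) => p Kp; rewrite normrM ler_pM ?b1 ?b2.
Qed.

Lemma tame_cst (k : R) : tame (cst k).
Proof. by apply: tame_continuous => p; exact: cvg_cst. Qed.

Hypotheses (r0 : 0 <= r) (ab : a < b).

Lemma tame_integrable f : tame f -> vol.-integrable K (EFin \o f).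
Proof.
move=> [mf [C fC]]; apply: measurable_bounded_integrable => //.
- exact: measurable_cylinder.
- have : (vol K < +oo)%E by rewrite volume_cylinder ?ltry// ltW.
  exact.
- exists C; split; first exact: num_real.
  by move=> M CM p Kp; exact: le_trans (fC _ Kp) (ltW CM).
Qed.

Lemma tame_RintegralD f g : tame f -> tame g ->
  \int[vol]_(p in K) (f p + g p) =
  \int[vol]_(p in K) f p + \int[vol]_(p in K) g p.
Proof.
move=> tf tg; apply: RintegralD; first exact: measurable_cylinder.
  exact: tame_integrable.
exact: tame_integrable.
Qed.

Lemma tame_RintegralZ (k : R) f : tame f ->
  \int[vol]_(p in K) (k * f p) = k * \int[vol]_(p in K) f p.
Proof.
move=> tf; apply: RintegralZl; first exact: measurable_cylinder.
exact: tame_integrable.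
Qed.

Lemma tame_le_Rintegral f g : tame f -> tame g ->
  (forall p, K p -> f p <= g p) ->
  \int[vol]_(p in K) f p <= \int[vol]_(p in K) g p.
Proof.
move=> tf tg fg; apply: (@le_Rintegral _ _ _ vol K f g measurable_cylinder).
- exact: tame_integrable.
- exact: tame_integrable.
- exact: fg.
Qed.

(** Fubini reduces this to the time integral of [dB] from [a] to [b], equal to
    [B b - B a] by the fundamental theorem of calculus. *)
Lemma integral_time_derivative (h : 'rV[R]_n -> R) (B dB : R -> R) :
  tame (fun p => h p.1 * dB p.2) ->
  (forall t, is_derive t (1 : R) B (dB t)) -> continuous dB ->
  B a = 0 -> B b = 0 ->
  \int[vol]_(p in K) (h p.1 * dB p.2) = 0.
Proof.
move=> tF dBP cdB Ba Bb.
pose F : V -> R := fun p => h p.1 * dB p.2.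
have iF : vol.-integrable setT (EFin \o (F \_ K)).
  have := tame_integrable tF; rewrite integrable_mkcond; last first.
    exact: measurable_cylinder.
  by rewrite restrict_EFin.
rewrite -[LHS]/(\int[vol]_(p in K) F p) Rintegral_mkcond /Rintegral.
rewrite -[X in fine X](integral12_prod_meas1 iF) /fubini_F/=.
rewrite integral0_eq// => x _.
have [xc|xc] := pselect (cube r c x); last first.
  by apply: integral0_eq => t _; rewrite patchE memNset//= => -[].
transitivity (\int[lebesgue_measure]_(t in `[a, b]) (h x * dB t)%:E)%E.
  rewrite [RHS]integral_mkcond; apply: eq_integral => t _.
  rewrite !patchE (_ : ((x, t) \in K) = (t \in `[a, b]%classic)).
    by case: ifP.
  by apply/idP/idP => /set_mem tK; apply/mem_set; [case: tK|split].
have dxB t : is_derive t (1 : R) (fun t => h x * B t) (h x * dB t).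
  exact: (is_deriveZ (h x) (dBP t)).
have cxB := is_derive_continuous dxB.
rewrite (@continuous_FTC2 _ _ (fun t => h x * B t) _ _ ab).
- by rewrite Ba Bb mulr0 subee.
- apply: continuous_subspaceT => t; apply: cvgM; first exact: cvg_cst.
  exact: cdB.
- split=> [t _||]; first by have [] := dxB t.
  + exact: cvg_at_right_filter (cxB a).
  + exact: cvg_at_left_filter (cxB b).
- by move=> t _; rewrite derive1E; have [] := dxB t.
Qed.

End cylinder_integrals.

(** * From weak to pointwise monotonicity in time *)

Section weak_monotonicity.
Context {R : realType} {n : nat}.
Local Set Implicit Arguments.
Local Unset Strict Implicit.
Local Notation V := ('rV[R]_n * R)%type.
Local Notation vol := (@lebesgue_rV R n \x @lebesgue_measure R)%E.

Lemma near_cylinder (A : set V) x (s : R) : nbhs (x, s) A ->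
  \forall d \near 0^'+, cube d x `*` `[s - d, s + d] `<=` A.
Proof.
move=> /nbhs_ballP[e /= e0 eA]; near=> d => -[y t] /= [xy st]; apply: eA.
have de : d < e by near: d; exact: nbhs_right_lt.
split=> /=.
  split=> // i j; rewrite ord1 /ball/= distrC.
  exact: le_lt_trans (xy j) de.
rewrite /ball/= distrC; apply: le_lt_trans de.
by rewrite ler_distl; move: st; rewrite in_itv.
Unshelve. all: by end_near. Qed.

Lemma continuous_snd_comp (g : R -> R) :
  continuous g -> continuous (fun p : V => g p.2).
Proof. by move=> cg p; apply: continuous_comp; [exact: cvg_snd|exact: cg]. Qed.

Lemma continuous_space_bump r (c : 'rV[R]_n) :
  continuous (fun p : V => space_bump r c p.1).
Proof. by move=> p; have [cs _] := Ck_space_bump 0 r c; exact: cs. Qed.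

(** Near [(x, s)] the function exceeds half of its value there, on a small
    cylinder of positive volume. *)
Lemma cylinder_integral_gt0 (r a b : R) (c x : 'rV[R]_n) (s : R) (g : V -> R) :
  let K := cube r c `*` `[a, b] in 0 <= r -> a < b ->
  tame r c a b g -> (forall p, K p -> 0 <= g p) ->
  nbhs (x, s) K -> {for (x, s), continuous g} -> 0 < g (x, s) ->
  0 < \int[vol]_(p in K) g p.
Proof.
move=> K r0 ab tg g0 Kx cg gx.
have gx2 : g (x, s) / 2 < g (x, s) by rewrite ltr_pdivrMr// mulr2n mulrDr mulr1 ltrDl.
have N : nbhs (x, s) (K `&` [set p | g (x, s) / 2 < g p]).
  by apply: filterI => //; exact: cvgr_gt cg _ gx2.
have [d [d0 dN]] : exists d, 0 < d /\
    cube d x `*` `[s - d, s + d] `<=` K `&` [set p | g (x, s) / 2 < g p].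
  near (0 : R)^'+ => d; exists d; split => //.
  by near: d; exact: near_cylinder.
pose K' := cube d x `*` `[s - d, s + d].
have K'K : K' `<=` K by move=> p /dN[].
have mK' : measurable K' by exact: measurable_cylinder.
pose f := cst (g (x, s) / 2) * \1_K' : V -> R.
have tf : tame r c a b f.
  apply: tameM; first exact: tame_cst.
  split; first by apply: measurable_funTS; exact: measurable_indic.
  by exists 1 => p _; rewrite indicE; case: (p \in K'); rewrite ?normr0 ?normr1.
apply: (@lt_le_trans _ _ (\int[vol]_(p in K) f p)); last first.
  apply: tame_le_Rintegral => // p Kp; rewrite /f !fctE indicE.
  case: (boolP (p \in K')) => [/set_mem pK'|_]; last by rewrite mulr0 g0.
  by rewrite mulr1; have [_ /ltW] := dN _ pK'.
rewrite (@Rintegral_support _ _ K K')//; last first.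
  by move=> p _ pK'; rewrite /f !fctE indicE memNset// mulr0.
rewrite (@eq_Rintegral _ _ _ vol K' (cst (g (x, s) / 2))); last first.
  by move=> p pK'; rewrite /f !fctE indicE pK' mulr1.
have vK : vol K' = ((d + d) ^+ n * (s + d - (s - d)))%:E.
  by apply: volume_cylinder; lra.
have /= -> := @Rintegral_cst _ _ _ vol K' mK' (g (x, s) / 2).
rewrite mulr_gt0 ?divr_gt0//; have := congr1 fine vK => /= ->.
by rewrite mulr_gt0 ?exprn_gt0//; lra.
Unshelve. all: by end_near. Qed.

(** Suppose [W (x, s) < W (x, t)] and let [m] be the midpoint.  On a thin cylinder
    [W < m - e] near time [s] and [m < W] near time [t], so [(W - m) * dwindow] is
    at most [- e] times the bump at [s].  Since [dwindow] has integral zero, the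
    constant [m] is invisible to the hypothesis, which then says that a negative
    number is nonnegative. *)
Lemma weak_nonincreasing (U : set V) (W : V -> R) (x : 'rV[R]_n) (s t : R) :
  (forall p, U p -> {for p, continuous W}) ->
  (forall r d, 0 < r -> 0 < d -> cube r x `*` `[s - d, t + d] `<=` U ->
    0 <= \int[vol]_(p in cube r x `*` `[s - d, t + d])
      (W p * (space_bump r x p.1 * dwindow d s t p.2))) ->
  s < t ->
  (\forall d \near 0^'+, cube d x `*` `[s - d, t + d] `<=` U) ->
  W (x, t) <= W (x, s).
Proof.
move=> cW HW st nU; rewrite leNgt; apply/negP => Wst.
(* e is a quarter of the gap, so that W (x, s) < m - e < m < W (x, t). *)
pose m := (W (x, s) + W (x, t)) / 2; pose e := (W (x, t) - W (x, s)) / 4.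
have e0 : 0 < e by rewrite /e; lra.
have [d [d0 [dU [ds dt]]]] : exists d, 0 < d /\
    (cube d x `*` `[s - d, t + d] `<=` U /\
    (cube d x `*` `[s - d, s + d] `<=` [set p | W p < m - e] /\
    cube d x `*` `[t - d, t + d] `<=` [set p | m < W p])).
  have [d0 [d0p d0U]] : exists d, 0 < d /\ cube d x `*` `[s - d, t + d] `<=` U.
    by near (0 : R)^'+ => d; exists d; split => //; near: d.
  have xU y : s <= y <= t -> U (x, y).
    move=> /andP[sy yt]; apply: d0U; split=> /=.
      by move=> i; rewrite subrr normr0 ltW.
    by rewrite in_itv/=; apply/andP; split; lra.
  near (0 : R)^'+ => d; exists d; split; [|split; [|split]] => //.
  - by near: d.
  - near: d; apply: near_cylinder.
    have /cW cWs : U (x, s) by apply: xU; rewrite lexx ltW.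
    by apply: cvgr_lt cWs _ _; rewrite /m /e; lra.
  - near: d; apply: near_cylinder.
    have /cW cWt : U (x, t) by apply: xU; rewrite lexx ltW.
    by apply: cvgr_gt cWt _ _; rewrite /m; lra.
have := HW _ _ d0 d0 dU; apply/negP; rewrite -ltNge.
pose K := cube d x `*` `[s - d, t + d].
have sdtd : s - d < t + d by lra.
have d0' := ltW d0.
have ta : tame d x (s - d) (t + d) (fun p => space_bump d x p.1).
  exact/tame_continuous/continuous_space_bump.
have tw : tame d x (s - d) (t + d) (fun p => dwindow d s t p.2).
  exact/tame_continuous/continuous_snd_comp/continuous_dwindow.
have cr : continuous (fun p : V => dramp d (p.2 - s)).
  apply: (@continuous_snd_comp (fun y => dramp d (y - s))) => y.
  apply: (@continuous_comp _ _ _ (fun y => y - s)); last exact: continuous_dramp.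
  by apply: cvgB; [exact: cvg_id|exact: cvg_cst].
have tW : tame d x (s - d) (t + d) W.
  apply: tame_within_continuous; apply: continuous_in_subspaceT => p /set_mem Kp.
  exact/cW/dU.
have tr : tame d x (s - d) (t + d) (fun p => dramp d (p.2 - s)).
  exact: tame_continuous.
pose q : V -> R := fun p => space_bump d x p.1 * dwindow d s t p.2.
pose h : V -> R := fun p => space_bump d x p.1 * dramp d (p.2 - s).
have tq : tame d x (s - d) (t + d) q by exact: tameM.
have th : tame d x (s - d) (t + d) h by exact: tameM.
have q0 : \int[vol]_(p in K) q p = 0.
  apply: (@integral_time_derivative _ _ _ _ _ _ _ _ _ (window d s t)) => //.
  - by move=> y; exact: is_derive_window.
  - exact: continuous_dwindow.
  - by apply: window_out; [exact: ltW|left].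
  - by apply: window_out; [exact: ltW|right].
have h0 : 0 < \int[vol]_(p in K) h p.
  apply: (@cylinder_integral_gt0 d (s - d) (t + d) x x s) => //.
  - by move=> p _; rewrite mulr_ge0 ?space_bump_ge0 ?dramp_ge0.
  - apply/nbhs_ballP; exists d => // -[y z] [/= [_ xy] sz]; split=> /=.
      by move=> i; rewrite distrC; exact/ltW/xy.
    move: sz; rewrite /ball/= distrC ltr_distl in_itv/= => /andP[sz1 sz2].
    by apply/andP; split; lra.
  - by apply: cvgM; [exact: continuous_space_bump|exact: cr].
  - by rewrite mulr_gt0// ?space_bump_center//= subrr dramp_gt0.
have tWq : tame d x (s - d) (t + d) (fun p => W p * q p) by exact: tameM.
have tmq : tame d x (s - d) (t + d) (fun p => m * q p).
  by apply: tameM => //; exact: tame_cst.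
have teh : tame d x (s - d) (t + d) (fun p => (- e) * h p).
  by apply: tameM => //; exact: tame_cst.
apply: (@le_lt_trans _ _ (\int[vol]_(p in K) (m * q p + (- e) * h p))).
  apply: tame_le_Rintegral => //; first exact: tameD.
  move=> [y z] [/= Ky Kz]; rewrite /q /h /=.
  set a := space_bump _ _ _; have a0 : 0 <= a by exact: space_bump_ge0.
  rewrite mulrCA [m * _]mulrCA [- e * _]mulrCA -mulrDr ler_wpM2l//.
  have b1 : (W (y, z) - m + e) * dramp d (z - s) <= 0.
    have [zs|zs] := leP d `|z - s|; first by rewrite dramp_out ?mulr0.
    rewrite mulr_le0_ge0 ?dramp_ge0//.
    have : W (y, z) < m - e.
      by apply: (ds (y, z)); split=> //=; rewrite in_itv/= -ler_distl ltW.
    lra.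
  have b2 : 0 <= (W (y, z) - m) * dramp d (z - t).
    have [zs|zs] := leP d `|z - t|; first by rewrite dramp_out ?mulr0.
    rewrite mulr_ge0 ?dramp_ge0// subr_ge0 ltW//.
    by apply: (dt (y, z)); split=> //=; rewrite in_itv/= -ler_distl ltW.
  by rewrite /dwindow; lra.
rewrite tame_RintegralD// !tame_RintegralZ// q0 mulr0 add0r.
by rewrite mulNr oppr_lt0 mulr_gt0.
Unshelve. all: by end_near. Qed.

End weak_monotonicity.

(** * Comparison of two solutions *)

Section comparison.
Context {R : realType} {n : nat}.
Local Set Implicit Arguments.
Local Unset Strict Implicit.
Local Notation V := ('rV[R]_n * R)%type.
Local Notation leb := (@lebesgue_rV R n).
Local Notation vol := (@lebesgue_rV R n \x @lebesgue_measure R)%E.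
Variables (Omega : set 'rV[R]_n) (mu : 'rV[R]_n -> R).
Hypotheses (Omega_open : open Omega) (mu_density : probability_density mu).
Local Notation frontier := (ext_frontier Omega mu).
Local Notation times := (@nneg_times R).
Implicit Types (phi psi u v : V -> R).

Lemma measurable_nneg_times : measurable times.
Proof.
have -> : times = `[0, +oo[%classic.
  by apply/seteqP; split=> x; rewrite /nneg_times/= in_itv/= andbT.
exact: measurable_itv.
Qed.

Lemma measurable_Omega : measurable Omega.
Proof. exact: measurable_open_rV. Qed.

Lemma measurable_frontier : measurable frontier.
Proof.
apply: measurableD; last exact: measurable_Omega.
by apply: measurable_closed_rV; exact: closed_closure.
Qed.

Lemma patch_Cb (D : set V) f : measurable D -> Cb D f ->
  measurable_fun setT (f \_ D) /\ exists C, forall p, `|(f \_ D) p| <= C.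
Proof.
move=> mD [cf [M [_ fM]]]; split.
  by apply/(measurable_restrictT _ mD); exact: within_continuous_measurable.
exists (`|M| + 1) => p; rewrite patchE; case: ifPn => [/set_mem Dp|_].
  apply: (fM (`|M| + 1)) => //.
  by rewrite (le_lt_trans (ler_norm _))// ltrDl.
by rewrite normr0 addr_ge0.
Qed.

(** The function whose average is the integral part of the nonlocal operator:
    the two domains of integration are disjoint. *)
Definition extension phi u : V -> R :=
  u \_ (Omega `*` times) + phi \_ (frontier `*` times).

Lemma CbS (D E : set V) f : D `<=` E -> Cb E f -> Cb D f.
Proof.
move=> DE [cf [M [Mr fM]]]; split; first exact: continuous_subspaceW cf.
by exists M; split=> // M' MM' x /DE; exact: fM.
Qed.

Section one_solution.
Variables (phi u : V -> R).
Hypotheses (u_Cb : Cb (Omega `*` times) u) (phi_Cb : Cb (frontier `*` times) phi).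

Let mOt : measurable (Omega `*` times).
Proof. exact: (measurableX measurable_Omega measurable_nneg_times). Qed.

Let mFt : measurable (frontier `*` times).
Proof. exact: (measurableX measurable_frontier measurable_nneg_times). Qed.

Lemma extension_measurable_bounded : measurable_fun setT (extension phi u) /\
  exists C, forall p, `|extension phi u p| <= C.
Proof.
have [m1 [C1 b1]] := patch_Cb mOt u_Cb.
have [m2 [C2 b2]] := patch_Cb mFt phi_Cb.
split; first exact: measurable_funD.
by exists (C1 + C2) => p; rewrite (le_trans (ler_normD _ _))// lerD.
Qed.

Lemma nonlocal_opE p : 0 <= p.2 ->
  nonlocal_op Omega mu phi u p = average mu (extension phi u) p - u p.
Proof.
move=> p0; congr (_ - _).
have [m1 [C1 b1]] := patch_Cb mOt u_Cb.
have [m2 [C2 b2]] := patch_Cb mFt phi_Cb.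
rewrite (averageD mu_density _ m1 b1 m2 b2); congr (_ + _).
  rewrite Rintegral_mkcond; apply: eq_Rintegral => z _; rewrite !patchE.
  rewrite (_ : (z \in _) = ((p.1 + z, p.2) \in Omega `*` times)).
    by case: ifP; rewrite ?mul0r.
  by apply/idP/idP => /set_mem H; apply/mem_set; [split|case: H].
rewrite Rintegral_mkcond; apply: eq_Rintegral => z _; rewrite !patchE.
rewrite (_ : (z \in _) = ((p.1 + z, p.2) \in frontier `*` times)).
  by case: ifP; rewrite ?mul0r.
by apply/idP/idP => /set_mem H; apply/mem_set; [split|case: H].
Qed.

(** The derivative of the test function [eta] is [eta + q], where [q] is the term
    with [dwindow].  Hence the equation reads
    [int u (eta + q) = - int (A - u) eta] with [A] the average, and [int u eta]
    cancels. *)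
Lemma weak_equation_bump (r : R) (c : 'rV[R]_n) (d s t : R) :
  0 < r -> 0 < d -> s < t ->
  cube r c `*` `[s - d, t + d] `<=` Omega `*` pos_times ->
  distr_dt_eq (Omega `*` pos_times) u (nonlocal_op Omega mu phi u) ->
  \int[vol]_(p in cube r c `*` `[s - d, t + d])
     (u p * (space_bump r c p.1 * (expR p.2 * dwindow d s t p.2))) =
  - \int[vol]_(p in cube r c `*` `[s - d, t + d])
     (average mu (extension phi u) p * cylinder_bump r c d s t p).
Proof.
move=> r0 d0 st KU eq_u; pose K := cube r c `*` `[s - d, t + d].
have sdtd : s - d < t + d by lra.
have r0' := ltW r0; have st' := ltW st.
have bump0 p : ~ K p -> cylinder_bump r c d s t p = 0 by exact: cylinder_bump_out.
have := eq_u _ (test_function_cylinder_bump r0' st' KU).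
under eq_Rintegral do rewrite derive_cylinder_bump.
rewrite (@Rintegral_support _ _ _ K)//; last first.
  move=> p _ pK; have [pc|pc] := pselect (cube r c p.1); last first.
    by rewrite space_bump_out// mul0r mulr0.
  have pt : p.2 <= s - d \/ t + d <= p.2.
    apply: contrapT => /not_orP[/negP + /negP]; rewrite -!ltNge => p1 p2.
    by apply: pK; split=> //=; rewrite in_itv/= !ltW.
  rewrite window_out// /dwindow !dramp_out ?subrr ?addr0 ?mulr0//.
    by rewrite ler_normr; case: pt => ?; apply/orP; [right|left]; lra.
  by rewrite ler_normr; case: pt => ?; apply/orP; [right|left]; lra.
rewrite [X in _ = - X](@Rintegral_support _ _ _ K)//; last first.
  by move=> p _ /bump0 ->; rewrite mulr0.
have tu : tame r c (s - d) (t + d) u.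
  apply: tame_within_continuous; apply: continuous_subspaceW u_Cb.1.
  by move=> p /KU [p1 p2]; split=> //; exact: ltW.
have ta : tame r c (s - d) (t + d) (fun p => space_bump r c p.1).
  exact/tame_continuous/continuous_space_bump.
have te : tame r c (s - d) (t + d) (fun p => expR p.2).
  exact/tame_continuous/continuous_snd_comp/continuous_expR.
have tdw : tame r c (s - d) (t + d) (fun p => dwindow d s t p.2).
  exact/tame_continuous/continuous_snd_comp/continuous_dwindow.
have tw : tame r c (s - d) (t + d) (fun p => window d s t p.2).
  apply/tame_continuous/continuous_snd_comp.
  exact: (is_derive_continuous (is_derive_window d s t)).
have tA : tame r c (s - d) (t + d) (average mu (extension phi u)).
  have [mE [C bE]] := extension_measurable_bounded; split.
    exact: measurable_funTS (measurable_average mu_density mE bE).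
  by exists C => p _; exact: (average_bound mu_density _ mE bE).
pose q : V -> R := fun p => space_bump r c p.1 * (expR p.2 * dwindow d s t p.2).
have tq : tame r c (s - d) (t + d) q by apply: tameM => //; exact: tameM.
have tb : tame r c (s - d) (t + d) (cylinder_bump r c d s t).
  by apply: tameM => //; exact: tameM.
have tuq : tame r c (s - d) (t + d) (fun p => u p * q p) by exact: tameM.
have tub : tame r c (s - d) (t + d) (fun p => u p * cylinder_bump r c d s t p).
  exact: tameM.
have tAb : tame r c (s - d) (t + d)
  (fun p => average mu (extension phi u) p * cylinder_bump r c d s t p) by exact: tameM.
rewrite (@eq_Rintegral _ _ _ vol K
  (fun p => u p * q p + u p * cylinder_bump r c d s t p)); last first.
  by move=> p _; rewrite /q /cylinder_bump; ring.
rewrite [X in _ = - X -> _](@eq_Rintegral _ _ _ vol K (fun p =>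
  average mu (extension phi u) p * cylinder_bump r c d s t p
  + (-1) * (u p * cylinder_bump r c d s t p))); last first.
  move=> p /set_mem /KU [_ /ltW p0]; rewrite nonlocal_opE//; ring.
rewrite !tame_RintegralD// ?tame_RintegralZ//; last first.
  by apply: tameM => //; exact: tame_cst.
by move=> H; rewrite -/K -/q; lra.
Qed.

End one_solution.

Lemma continuous_at_interior (D U : set V) (f : V -> R) p :
  open U -> U `<=` D -> {within D, continuous f} -> U p ->
  {for p, continuous f}.
Proof.
move=> oU UD /subspace_continuousP cf Up.
have UDi : U `<=` D^° by rewrite -open_subsetE.
by have := cf _ (UD _ Up); rewrite within_interior//; exact: UDi.
Qed.

Lemma open_cylinder (A : set 'rV[R]_n) (B : set R) :
  open A -> open B -> open (A `*` B).
Proof.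
move=> oA oB; apply: (@openI _ (fst @^-1` A) (snd @^-1` B)).
  by apply: open_comp => // p _; exact: cvg_fst.
by apply: open_comp => // p _; exact: cvg_snd.
Qed.

Variables (phi psi u v : V -> R).
Hypotheses (u_Cb : Cb (Omega `*` times) u) (phi_Cb : Cb (frontier `*` times) phi)
  (v_Cb : Cb (Omega `*` times) v) (psi_Cb : Cb (frontier `*` times) psi).
Hypothesis u_eq :
  distr_dt_eq (Omega `*` pos_times) u (nonlocal_op Omega mu phi u).
Hypothesis v_eq :
  distr_dt_eq (Omega `*` pos_times) v (nonlocal_op Omega mu psi v).
Hypothesis phi_le_psi : forall p, (frontier `*` times) p -> phi p <= psi p.

Variables (M T : R).
Hypotheses (M0 : 0 <= M)
  (uvM : forall x (t : R), Omega x -> 0 <= t < T -> u (x, t) - v (x, t) <= M).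

(** On the time slice of [p] the first extension exceeds the second by at most
    [M], and averages are monotone and preserve constants. *)
Lemma average_extension_le (p : V) : 0 <= p.2 < T ->
  average mu (extension phi u) p <= average mu (extension psi v) p + M.
Proof.
move=> /andP[p0 pT].
have [mu1 [C1 b1]] := extension_measurable_bounded u_Cb phi_Cb.
have [mv1 [C2 b2]] := extension_measurable_bounded v_Cb psi_Cb.
have bM (q : V) : `|(cst M : V -> R) q| <= M by rewrite ger0_norm.
rewrite -[X in _ + X](average_cst mu_density M p).
rewrite -(averageD mu_density _ mv1 b2 _ bM)//.
apply: (@average_le _ _ _ mu_density _ _ C1 (C2 + M)) => //.
- exact: measurable_funD.
- by move=> q; rewrite (le_trans (ler_normD _ _))// lerD ?b2.
move=> x; rewrite /extension !fctE !patchE.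
have tp : times p.2 by [].
have [xO|xO] := pselect (Omega x).
  rewrite [(_ \in Omega `*` _)]mem_set// memNset; last by move=> [[]].
  by rewrite !addr0 -lerBlDl uvM// p0.
rewrite [(_ \in Omega `*` _)]memNset; last by move=> [].
rewrite !add0r; case: ifPn => [/set_mem xF|_]; last by rewrite add0r.
by rewrite (le_trans (phi_le_psi xF))// lerDl.
Qed.

(** With [A_u] and [A_v] the two averages, and [eta] and [q] as in
    [weak_equation_bump], that lemma gives
    [int (u - v - M) q = int (A_v + M - A_u) eta >= 0]; the constant [M] enters
    through [int q = - int eta], which holds because [q + eta] is a time
    derivative. *)
Lemma exp_weighted_nonincreasing x (s t : R) :
  Omega x -> 0 < s -> s < t -> t < T ->
  (u (x, t) - v (x, t) - M) * expR t <= (u (x, s) - v (x, s) - M) * expR s.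
Proof.
move=> Ox s0 st tT.
pose U : set V := Omega `*` [set y | 0 < y < T].
have oU : open U.
  apply: open_cylinder => //.
  rewrite (_ : mkset _ = `]0, T[%classic); first exact: interval_open.
  by apply/seteqP; split=> y; rewrite /= in_itv.
have UO : U `<=` Omega `*` times by move=> p [p1 /andP[/ltW]].
have UP : U `<=` Omega `*` pos_times by move=> p [p1 /andP[]].
pose W : V -> R := fun p => (u p - v p - M) * expR p.2.
apply: (@weak_nonincreasing _ _ U W x s t) => //.
- move=> p Up; apply: cvgM; last exact/continuous_snd_comp/continuous_expR.
  apply: cvgB; last exact: cvg_cst.
  apply: cvgB; first exact: continuous_at_interior oU UO u_Cb.1 Up.
  exact: continuous_at_interior oU UO v_Cb.1 Up.
- move=> r d r0 d0 KU; pose K := cube r x `*` `[s - d, t + d].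
  have sdtd : s - d < t + d by lra.
  have r0' := ltW r0; have st' := ltW st.
  have KP := subset_trans KU UP.
  pose q : V -> R := fun p => space_bump r x p.1 * (expR p.2 * dwindow d s t p.2).
  have ta : tame r x (s - d) (t + d) (fun p => space_bump r x p.1).
    exact/tame_continuous/continuous_space_bump.
  have te : tame r x (s - d) (t + d) (fun p => expR p.2).
    exact/tame_continuous/continuous_snd_comp/continuous_expR.
  have tdw : tame r x (s - d) (t + d) (fun p => dwindow d s t p.2).
    exact/tame_continuous/continuous_snd_comp/continuous_dwindow.
  have cw := is_derive_continuous (is_derive_window d s t).
  have tw : tame r x (s - d) (t + d) (fun p => window d s t p.2).
    exact/tame_continuous/continuous_snd_comp.
  have tame_uv f : Cb (Omega `*` times) f -> tame r x (s - d) (t + d) f.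
    move=> [cf _]; apply: tame_within_continuous.
    by apply: continuous_subspaceW cf => p /KU /UO.
  have tu := tame_uv _ u_Cb; have tv := tame_uv _ v_Cb.
  have tq : tame r x (s - d) (t + d) q by apply: tameM => //; exact: tameM.
  pose eta := cylinder_bump r x d s t.
  have teta : tame r x (s - d) (t + d) eta by apply: tameM => //; exact: tameM.
  have tameA f g : Cb (Omega `*` times) f -> Cb (frontier `*` times) g ->
      tame r x (s - d) (t + d) (average mu (extension g f)).
    move=> Cf Cg; have [mE [C bE]] := extension_measurable_bounded Cf Cg; split.
      exact: measurable_funTS (measurable_average mu_density mE bE).
    by exists C => p _; exact: (average_bound mu_density _ mE bE).
  have tAu := tameA _ _ u_Cb phi_Cb; have tAv := tameA _ _ v_Cb psi_Cb.
  have Eu := weak_equation_bump u_Cb phi_Cb r0 d0 st KP u_eq.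
  have Ev := weak_equation_bump v_Cb psi_Cb r0 d0 st KP v_eq.
  have Eq : \int[vol]_(p in K) q p = - \int[vol]_(p in K) eta p.
    pose dB y := expR y *: dwindow d s t y + window d s t y *: expR y.
    have tdB : tame r x (s - d) (t + d) (fun p => space_bump r x p.1 * dB p.2).
      by apply: tameM => //; apply: tameD; exact: tameM.
    have H : \int[vol]_(p in K) (space_bump r x p.1 * dB p.2) = 0.
      apply: (@integral_time_derivative _ _ _ _ _ _ r0' sdtd _
        (expR * window d s t)); first exact: tdB.
      + by move=> y; exact: (is_deriveM (is_derive_expR y) (is_derive_window d s t y)).
      + by move=> y; apply: cvgD; apply: cvgM; first
          [exact: continuous_expR|exact: continuous_dwindow|exact: cw].
      + by rewrite fctE (window_out st') ?mulr0//; left.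
      + by rewrite fctE (window_out st') ?mulr0//; right.
    apply/eqP; rewrite -addr_eq0 -tame_RintegralD// -{}H; apply/eqP.
    apply: eq_Rintegral => p _.
    by rewrite /q /eta /dB /cylinder_bump /GRing.scale/=; ring.
  rewrite -/K (@eq_Rintegral _ _ _ vol K
    (fun p => u p * q p + (-1) * (v p * q p) + (- M) * q p)); last first.
    by move=> p _; rewrite /W /q; ring.
  have tm (k : R) f : tame r x (s - d) (t + d) f ->
      tame r x (s - d) (t + d) (fun p => k * f p).
    by apply: tameM; exact: tame_cst.
  have tuq : tame r x (s - d) (t + d) (fun p => u p * q p) by exact: tameM.
  have tvq : tame r x (s - d) (t + d) (fun p => v p * q p) by exact: tameM.
  have tuvq : tame r x (s - d) (t + d) (fun p => u p * q p + (-1) * (v p * q p)).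
    by apply: tameD => //; exact: tm.
  rewrite !tame_RintegralD ?tame_RintegralZ//; try exact: tm.
  rewrite -/K -/q in Eu Ev; rewrite Eu Ev Eq mulN1r opprK mulrN mulNr opprK.
  rewrite -[M * _]tame_RintegralZ// -subr_ge0 subr0 -!addrA addrC.
  rewrite subr_ge0 -tame_RintegralD//; [|exact: tameM|exact: tm].
  apply: tame_le_Rintegral => //; first exact: tameM.
    by apply: tameD; [exact: tameM|exact: tm].
  move=> p /KU[_ /andP[p0 pT]]; rewrite -mulrDl ler_wpM2r//.
    rewrite /eta /cylinder_bump mulr_ge0 ?space_bump_ge0//.
    by rewrite mulr_ge0 ?expR_ge0 ?window_ge0.
  by apply: average_extension_le; rewrite ltW.
- have N : nbhs (x, s) (Omega `*` [set: R]).
    by apply: open_nbhs_nbhs; split=> //; exact: open_cylinder openT.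
  near=> d => -[y z] [/= xy]; rewrite in_itv/= => /andP[z1 z2]; split=> /=.
    have : (cube d x `*` `[s - d, s + d] `<=` Omega `*` [set: R]).
      by near: d; exact: near_cylinder.
    move=> /(_ (y, s))[]//=; split=> //=; rewrite in_itv/=.
    have d0 : 0 < d by [].
    by apply/andP; split; lra.
  have ds : d < s by near: d; exact: nbhs_right_lt.
  have dt : d < T - t by near: d; apply: nbhs_right_lt; rewrite subr_gt0.
  by apply/andP; split; lra.
Unshelve. all: by end_near. Qed.

Hypothesis uv0 : forall x, Omega x -> u (x, 0) <= v (x, 0).

(** Let [s] tend to [0] in [exp_weighted_nonincreasing]: the weighted difference
    at time [0] is at most [- M]. *)
Lemma exp_weighted_le_initial x (t : R) : Omega x -> 0 <= t < T ->
  u (x, t) - v (x, t) <= M * (1 - expR (- t)).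
Proof.
move=> Ox /andP[t0 tT]; have uv0x := uv0 Ox.
have [tz|t0'] := eqVneq t 0.
  by rewrite tz oppr0 expR0 subrr mulr0 subr_le0.
have {t0'}tp : 0 < t by rewrite lt_def t0'.
have tt : times 0 by rewrite /nneg_times/=.
have D0 : (Omega `*` times) (x, 0) by [].
pose W : V -> R := fun p => (u p - v p - M) * expR p.2.
have cW : W @ within (Omega `*` times) (nbhs (x, 0 : R)) --> W (x, 0).
  apply: cvgM.
    apply: cvgB; last exact: cvg_cst.
    apply: cvgB; [have [/subspace_continuousP c _] := u_Cb|
                  have [/subspace_continuousP c _] := v_Cb]; exact: c.
  apply: cvg_within_filter.
  exact: (@continuous_snd_comp _ _ expR (@continuous_expR R)).
have Wt : W (x, t) <= - M.
  apply/ler_addgt0Pr => e e0.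
  have We : \forall p \near within (Omega `*` times) (nbhs (x, 0 : R)),
      W p < - M + e.
    apply: cvgr_lt cW _ _; rewrite /W /= expR0 mulr1; lra.
  have /nbhs_ballP[d d0 dW] := We.
  near (0 : R)^'+ => s.
  have s0 : 0 < s by [].
  have Ws : W (x, s) < - M + e.
    apply: dW; last by split=> //; exact: ltW.
    split=> /=; first exact: ballxx.
    by rewrite /ball/= sub0r normrN gtr0_norm//.
  by apply: (le_trans _ (ltW Ws)); apply: exp_weighted_nonincreasing => //.
move: Wt; rewrite /W /= -ler_pdivlMr ?expR_gt0// expRN; lra.
Unshelve. all: by end_near. Qed.

End comparison.

(** * The comparison principle *)

(** The supremum of the positive part satisfies [M <= M * (1 - expR (- T))], hence
    vanishes. *)
Lemma contraction_le0 {R : realType} {X : Type} (D : set X) (w : X -> R)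
    (T C : R) :
  (forall p, D p -> w p <= C) ->
  (forall M, 0 <= M -> (forall p, D p -> w p <= M) ->
    forall p, D p -> w p <= M * (1 - expR (- T))) ->
  forall p, D p -> w p <= 0.
Proof.
move=> wC step p Dp.
pose S := 0 |` [set w q | q in D].
have hS : has_sup S.
  split; first by exists 0; left.
  exists (Num.max 0 C) => _ [->|[q Dq <-]]; first by rewrite le_max lexx.
  by rewrite le_max wC// orbT.
have M0 : 0 <= sup S by apply: sup_upper_bound => //; left.
have wM q : D q -> w q <= sup S.
  by move=> Dq; apply: sup_upper_bound => //; right; exists q.
have k0 : 0 < expR (- T) by exact: expR_gt0.
have : sup S <= Num.max 0 (sup S * (1 - expR (- T))).
  apply: sup_le_ub => [|_ [->|[q Dq <-]]]; first by case: hS.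
    by rewrite le_max lexx.
  by rewrite le_max step// orbT.
rewrite le_max => /orP[S0|S0]; first exact: le_trans (wM _ Dp) S0.
apply: le_trans (wM _ Dp) _.
rewrite -(pmulr_lle0 _ k0); lra.
Qed.

Lemma le0_closure {R : realType} {n : nat} (A : set 'rV[R]_n) (B : set R)
    (w : 'rV[R]_n * R -> R) :
  {within closure A `*` B, continuous w} ->
  (forall p, (A `*` B) p -> w p <= 0) ->
  forall p, (closure A `*` B) p -> w p <= 0.
Proof.
move=> /subspace_continuousP cw wA [x t] [/= Ax Bt].
rewrite leNgt; apply/negP => wp.
have : \forall q \near within (closure A `*` B) (nbhs (x, t)), 0 < w q.
  by apply: cvgr_gt (cw (x, t) _) _ wp.
move=> /nbhs_ballP[d d0 dw].
have [y [Ay xy]] := Ax _ (nbhsx_ballx x d d0).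
have : 0 < w (y, t).
  by apply: dw; split=> //=; [exact: ballxx|exact: subset_closure].
by rewrite ltNge wA.
Qed.

Theorem proposition3p2 (R : realType) (n : nat) (hn : (0 < n)%N)
  (Omega : set 'rV[R]_n) (mu : 'rV[R]_n -> R)
  (Omega_open : open Omega) (Omega_bounded : bounded_set Omega)
  (Omega_connected : connected Omega) (Omega_regular : smooth_boundary Omega)
  (mu_density : probability_density mu)
  (u0 v0 : 'rV[R]_n -> R) (phi psi u v : 'rV[R]_n * R -> R)
  (u0_phi : admissible_data Omega mu u0 phi)
  (v0_psi : admissible_data Omega mu v0 psi)
  (uX : Cb (closure Omega `*` nneg_times) u)
  (vX : Cb (closure Omega `*` nneg_times) v)
  (u_sol : dirichlet_solution Omega mu u0 phi u)
  (v_sol : dirichlet_solution Omega mu v0 psi v)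
  (u0_le_v0 : forall x, Omega x -> u0 x <= v0 x)
  (phi_le_psi : forall p, (ext_frontier Omega mu `*` nneg_times) p ->
    phi p <= psi p) :
  forall p, (closure Omega `*` nneg_times) p -> u p <= v p.
Proof.
have [_ phiCb _] := u0_phi; have [_ psiCb _] := v0_psi.
have [_ u_eq u_init] := u_sol; have [_ v_eq v_init] := v_sol.
have sub : Omega `*` @nneg_times R `<=` closure Omega `*` @nneg_times R.
  by move=> q [q1 q2]; split=> //; exact: subset_closure.
have uCb := CbS sub uX; have vCb := CbS sub vX.
have uv0 x : Omega x -> u (x, 0) <= v (x, 0).
  by move=> Ox; rewrite u_init// v_init// u0_le_v0.
move=> p Kp; rewrite -subr_le0.
apply: (@le0_closure _ _ Omega nneg_times (fun p => u p - v p)) Kp => {p}.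
  by move=> p; apply: cvgB; [exact: uX.1|exact: vX.1].
move=> [x t] [/= Ox t0].
pose T := t + 1.
have [_ [C uC]] : measurable_fun setT (u \_ (Omega `*` nneg_times)) /\ _ :=
  patch_Cb (measurableX (measurable_Omega Omega_open) measurable_nneg_times) uCb.
have [_ [C' vC]] : measurable_fun setT (v \_ (Omega `*` nneg_times)) /\ _ :=
  patch_Cb (measurableX (measurable_Omega Omega_open) measurable_nneg_times) vCb.
apply: (@contraction_le0 _ _ (Omega `*` [set y | 0 <= y < T])
    (fun p => u p - v p) T (C + C')) => /=.
- move=> p [p1 /andP[p2 _]].
  have Dp : (Omega `*` nneg_times) p by [].
  have := uC p; have := vC p; rewrite !patchE mem_set//.
  by rewrite !ler_norml => /andP[? ?] /andP[? ?]; lra.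
- move=> M M0 HM [y s] [/= Oy /[dup] sT /andP[s0 sT']].
  apply: le_trans (_ : M * (1 - expR (- s)) <= _).
    apply: (exp_weighted_le_initial Omega_open mu_density uCb phiCb vCb psiCb
      u_eq v_eq phi_le_psi M0 _ uv0 Oy sT).
    by move=> z r Oz rT; exact: (HM (z, r)).
  by rewrite ler_wpM2l// lerD2l lerN2 ler_expR lerN2 ltW.
- by split=> //=; apply/andP; split=> //; rewrite /T ltrDl.
Qed.
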